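(* Let $\Gamma$ be a totally ordered set, $(A_\gamma)_{\gamma\in\Gamma}$ a family of nonzero abelian groups, and let $\mathbb{G}=\mathbf{H}_\Gamma A_\gamma$ be the Hahn product over the skeleton $S=[\Gamma;\{A_\gamma:\gamma\in\Gamma\}]$. Let $\mathcal{F}$ be a group family with respect to $\Gamma$. Then the Rayner group $G=\mathbb{G}(\mathcal{F})=\{g\in\mathbb{G}:\operatorname{supp}(g)\in\mathcal{F}\}$ has the canonical lifting property with respect to the skeleton if and only if $\mathcal{F}$ is stable under the action of $\mathrm{Aut}\,S$, that is, for all $[\bar\tau;\{\tau_\gamma:\gamma\in\Gamma\}]\in\mathrm{Aut}\,S$ and all $T\in\mathcal{F}$ we have $\bar\tau(T)\in\mathcal{F}$.
   Context: For $a=(a_\gamma)\in\prod_{\gamma\in\Gamma}A_\gamma$ let $\operatorname{supp}(a)=\{\gamma: a_\gamma\ne 0\}$. The Hahn product $\mathbf{H}_\Gamma A_\gamma$ is the group of all $a\in\prod_\Gamma A_\gamma$ with well ordered support; its elements are written $\sum_\gamma a_\gamma\mathbb{1}_\gamma:=(a_\gamma)_{\gamma\in\Gamma}$. A group family with respect to $\Gamma$ is a family $\mathcal{F}$ of subsets of $\Gamma$ such that: (i) every element of $\mathcal{F}$ is a well ordered subset of $\Gamma$; (ii) $A,B\in\mathcal{F}\Rightarrow A\cup B\in\mathcal{F}$; (iii) $A\in\mathcal{F}$ and $B\subseteq A$ imply $B\in\mathcal{F}$. An automorphism of $S$ is a tuple $\tau=[\bar\tau;\{\tau_\gamma:\gamma\in\Gamma\}]$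 with $\bar\tau$ an order automorphism of $\Gamma$ and, for each $\gamma$, a group isomorphism $\tau_\gamma\colon A_\gamma\to A_{\bar\tau(\gamma)}$; $\mathrm{Aut}\,S$ is the group of these under composition. The canonical lift of $\tau$ to $\mathbb{G}$ is the automorphism $\tilde\tau$ of $\mathbb{G}$ given by $\tilde\tau\left(\sum_\gamma g_\gamma\mathbb{1}_\gamma\right)=\sum_\gamma\tau_\gamma(g_\gamma)\mathbb{1}_{\bar\tau(\gamma)}$. A subgroup $G\le\mathbb{G}$ has the canonical lifting property with respect to the skeleton if $\tilde\tau(G)=G$ for every $\tau\in\mathrm{Aut}\,S$. *)

(* Defs.v *)
From HB Require Import structures.
From mathcomp Require Import all_boot all_order all_algebra.
From mathcomp Require Import boolp classical_sets wochoice.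

Set Implicit Arguments.
Unset Strict Implicit.
Unset Printing Implicit Defensive.

Import Order.TTheory GRing.Theory.
Local Open Scope classical_set_scope.
Local Open Scope ring_scope.

Definition well_ordered_set (d : Order.disp_t) (Gamma : orderType d)
    (T : set Gamma) : Prop :=
  wo_chain (fun x y : Gamma => (x <= y)%O) (mem T).

Section WellOrdered.
Context {d : Order.disp_t} {Gamma : orderType d}.
Implicit Types T U : set Gamma.

Lemma well_ordered_setP T :
  well_ordered_set T <->
  (forall B : set Gamma, B `<=` T -> B !=set0 ->
     exists2 m, B m & forall x, B x -> (m <= x)%O).
Proof.
split=> [woT B BT [b Bb] | woT B BT [b Bb]].
  have [||m [[/set_mem Bm mB] _]] := woT (mem B).
  - by move=> x /set_mem Bx; apply/mem_set/BT.
  - by exists b; apply/mem_set.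
  by exists m => // x Bx; apply/mB/mem_set.
have [||m /= Bm mB] := woT [set x | x \in B].
- by move=> x /= Bx; apply/set_mem/BT.
- by exists b.
exists m; split=> [|m' [Bm' m'B]]; first by split.
by apply: le_anti; rewrite mB // m'B.
Qed.

Lemma well_ordered_sub T U :
  U `<=` T -> well_ordered_set T -> well_ordered_set U.
Proof.
move=> UT /well_ordered_setP woT; apply/well_ordered_setP => B BU.
by apply: woT => x /BU/UT.
Qed.

Lemma well_ordered_set0 : well_ordered_set (set0 : set Gamma).
Proof. by apply/well_ordered_setP => B B0 [x /B0]. Qed.

Lemma well_ordered_setU T U :
  well_ordered_set T -> well_ordered_set U -> well_ordered_set (T `|` U).
Proof.
move=> /well_ordered_setP woT /well_ordered_setP woU.
apply/well_ordered_setP => B BTU [b Bb].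
have [neT|eT] := pselect (B `&` T !=set0); last first.
  apply: woU; last by exists b.
  by move=> x Bx; have [Tx|//] := BTU x Bx; case: eT; exists x.
have [neU|eU] := pselect (B `&` U !=set0); last first.
  apply: woT; last by exists b.
  by move=> x Bx; have [//|Ux] := BTU x Bx; case: eU; exists x.
have [|t [Bt Tt] tB] := woT (B `&` T) _ neT; first by move=> x [].
have [|u [Bu Uu] uB] := woU (B `&` U) _ neU; first by move=> x [].
have [tu|ut] := leP t u.
  exists t => // x Bx; have [Tx|Ux] := BTU x Bx; first exact: tB.
  exact: le_trans tu (uB x _).
exists u => // x Bx; have [Tx|Ux] := BTU x Bx; last exact: uB.
exact: le_trans (ltW ut) (tB x _).
Qed.

Lemma well_ordered_image (f : Gamma -> Gamma) T :
    {mono f : x y / (x <= y)%O} ->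
  well_ordered_set T -> well_ordered_set (f @` T).
Proof.
move=> fmono /well_ordered_setP woT; apply/well_ordered_setP => B BfT [b Bb].
have [||m [Tm Bfm] mB] := woT [set x | T x /\ B (f x)].
- by move=> x [].
- by have [x Tx fxb] := BfT b Bb; exists x; rewrite /= fxb.
exists (f m) => // y By; have [x Tx fxy] := BfT y By.
by rewrite -fxy fmono; apply: mB; rewrite /= fxy.
Qed.

End WellOrdered.

Definition supp (I : Type) (A : I -> zmodType) (a : forall i, A i) : set I :=
  [set i | a i != 0].

Record hahn_product (d : Order.disp_t) (Gamma : orderType d)
    (A : Gamma -> zmodType) := HahnProduct {
  hahn_coef :> forall gamma, A gamma;
  hahn_supp : well_ordered_set (supp hahn_coef)
}.

HB.instance Definition _ (d : Order.disp_t) (Gamma : orderType d)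
  (A : Gamma -> zmodType) := gen_eqMixin (hahn_product A).
HB.instance Definition _ (d : Order.disp_t) (Gamma : orderType d)
  (A : Gamma -> zmodType) := gen_choiceMixin (hahn_product A).

Section HahnGroup.
Context {d : Order.disp_t} {Gamma : orderType d} {A : Gamma -> zmodType}.
Implicit Types a b c : hahn_product A.

Lemma hahnP a b : (forall gamma, a gamma = b gamma) -> a = b.
Proof.
case: a b => [a woa] [b wob] /= ab.
have {}ab : a = b by apply: functional_extensionality_dep.
case: _ / ab in wob *; congr HahnProduct; exact: Prop_irrelevance.
Qed.

Lemma supp_zero : supp (fun gamma : Gamma => 0 : A gamma) = set0.
Proof. by rewrite -subset0 => gamma; rewrite /supp /= eqxx. Qed.

Lemma supp_opp a : supp (fun gamma => - a gamma) = supp a.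
Proof. by apply/seteqP; split=> gamma; rewrite /supp /= oppr_eq0. Qed.

Lemma supp_add a b : supp (fun gamma => a gamma + b gamma) `<=` supp a `|` supp b.
Proof.
move=> gamma; rewrite /supp /=; have [->|] := eqVneq (a gamma) 0; last by left.
by rewrite add0r; right.
Qed.

Fact hahn_zero_subproof :
  well_ordered_set (supp (fun gamma : Gamma => 0 : A gamma)).
Proof. by rewrite supp_zero; apply: well_ordered_set0. Qed.

Fact hahn_opp_subproof a : well_ordered_set (supp (fun gamma => - a gamma)).
Proof. by rewrite supp_opp; apply: hahn_supp. Qed.

Fact hahn_add_subproof a b :
  well_ordered_set (supp (fun gamma => a gamma + b gamma)).
Proof.
apply: (well_ordered_sub (supp_add (a := a) (b := b))).
by apply: well_ordered_setU; apply: hahn_supp.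
Qed.

Definition hahn_zero : hahn_product A := HahnProduct hahn_zero_subproof.
Definition hahn_opp a : hahn_product A := HahnProduct (@hahn_opp_subproof a).
Definition hahn_add a b : hahn_product A := HahnProduct (@hahn_add_subproof a b).

Fact hahn_addA : associative hahn_add.
Proof. by move=> a b c; apply: hahnP => gamma /=; rewrite addrA. Qed.

Fact hahn_addC : commutative hahn_add.
Proof. by move=> a b; apply: hahnP => gamma /=; rewrite addrC. Qed.

Fact hahn_add0 : left_id hahn_zero hahn_add.
Proof. by move=> a; apply: hahnP => gamma /=; rewrite add0r. Qed.

Fact hahn_addN : left_inverse hahn_zero hahn_opp hahn_add.
Proof. by move=> a; apply: hahnP => gamma /=; rewrite addNr. Qed.

HB.instance Definition _ := GRing.isZmodule.Build (hahn_product A)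
  hahn_addA hahn_addC hahn_add0 hahn_addN.

End HahnGroup.

Definition group_family (d : Order.disp_t) (Gamma : orderType d)
    (F : set (set Gamma)) : Prop :=
  [/\ forall T, F T -> well_ordered_set T,
      forall T U, F T -> F U -> F (T `|` U)
    & forall T U, F T -> U `<=` T -> F U].

Definition rayner_group (d : Order.disp_t) (Gamma : orderType d)
    (A : Gamma -> zmodType) (F : set (set Gamma)) : set (hahn_product A) :=
  [set g | F (supp g)].
Arguments rayner_group {d Gamma} A F.

Record skeleton_aut (d : Order.disp_t) (Gamma : orderType d)
    (A : Gamma -> zmodType) := SkeletonAut {
  aut_bar : Gamma -> Gamma;
  aut_bar_bij : bijective aut_bar;
  aut_bar_mono : {mono aut_bar : x y / (x <= y)%O};
  aut_comp : forall gamma, {additive A gamma -> A (aut_bar gamma)};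
  aut_comp_bij : forall gamma, bijective (aut_comp gamma)
}.

Section CanonicalLift.
Context {d : Order.disp_t} {Gamma : orderType d} {A : Gamma -> zmodType}.
Implicit Types (tau : skeleton_aut A) (g : hahn_product A).

Lemma aut_bar_surj tau delta : {gamma | aut_bar tau gamma = delta}.
Proof. by apply: cid; have [h _ barK] := aut_bar_bij tau; exists (h delta). Qed.

(* The coefficient at delta is tau_gamma (g_gamma) for the unique gamma with
   bar tau gamma = delta, transported from A (bar tau gamma) to A delta; see
   lift_coefE. *)
Definition lift_coef tau g : forall delta, A delta := fun delta =>
  let: exist gamma bar_gamma := aut_bar_surj tau delta in
  ecast x (A x) bar_gamma (aut_comp tau gamma (g gamma)).

Lemma lift_coefE tau g gamma :
  lift_coef tau g (aut_bar tau gamma) = aut_comp tau gamma (g gamma).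
Proof.
rewrite /lift_coef; case: aut_bar_surj => gamma' e.
have ee : gamma' = gamma by apply: (bij_inj (aut_bar_bij tau)).
by case: _ / ee in e *; rewrite (Prop_irrelevance e erefl).
Qed.

Lemma supp_lift_coef tau g :
  supp (lift_coef tau g) = aut_bar tau @` supp g.
Proof.
have comp0 gamma : (aut_comp tau gamma (g gamma) == 0) = (g gamma == 0).
  by rewrite -(raddf0 (aut_comp tau gamma)) (inj_eq (bij_inj (aut_comp_bij _ _))).
apply/seteqP; split=> [delta | _ [gamma + <-]]; last first.
  by rewrite /supp /= lift_coefE comp0.
have [gamma <-] := aut_bar_surj tau delta.
by rewrite /supp /= lift_coefE comp0 => gN0; exists gamma.
Qed.

Fact canonical_lift_subproof tau g : well_ordered_set (supp (lift_coef tau g)).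
Proof.
rewrite supp_lift_coef; apply: well_ordered_image (@hahn_supp _ _ _ g).
exact: aut_bar_mono.
Qed.

Definition canonical_lift tau g : hahn_product A :=
  HahnProduct (@canonical_lift_subproof tau g).

Fact canonical_lift_is_additive tau : zmod_morphism (canonical_lift tau).
Proof.
move=> a b; apply: hahnP => delta; have [gamma <-] := aut_bar_surj tau delta.
change (lift_coef tau (a - b) (aut_bar tau gamma) =
  lift_coef tau a (aut_bar tau gamma) - lift_coef tau b (aut_bar tau gamma)).
by rewrite !lift_coefE -raddfB.
Qed.

HB.instance Definition _ tau := GRing.isZmodMorphism.Build
  (hahn_product A) (hahn_product A) (canonical_lift tau)
  (canonical_lift_is_additive tau).

End CanonicalLift.

Definition canonical_lifting_property (d : Order.disp_t) (Gamma : orderType d)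
    (A : Gamma -> zmodType) (G : set (hahn_product A)) : Prop :=
  forall tau : skeleton_aut A, canonical_lift tau @` G = G.

Definition stable_under_aut (d : Order.disp_t) (Gamma : orderType d)
    (A : Gamma -> zmodType) (F : set (set Gamma)) : Prop :=
  forall (tau : skeleton_aut A) (T : set Gamma), F T -> F (aut_bar tau @` T).
Arguments stable_under_aut {d Gamma} A F.

Lemma rayner_group_subgroup (d : Order.disp_t) (Gamma : orderType d)
    (A : Gamma -> zmodType) (F : set (set Gamma)) :
  group_family F -> F !=set0 -> zmod_closed (mem (rayner_group A F)).
Proof.
move=> [_ FU FS] [T FT]; split.
  by apply/mem_set; rewrite /rayner_group /= supp_zero; apply: FS FT _.
move=> a b /set_mem Fa /set_mem Fb; apply/mem_set.
apply: FS (FU _ _ Fa Fb) _; rewrite -(@supp_opp _ _ _ b).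
exact: (@supp_add _ _ _ a (hahn_opp b)).
Qed.

(* Main.v *)
From HB Require Import structures.
Require Import Defs.
From mathcomp Require Import all_boot all_order all_algebra.
From mathcomp Require Import boolp classical_sets.

(** The canonical lift of [tau] moves supports by [aut_bar tau]: this is
    [supp_lift_coef].  So the theorem compares two actions on supports, and
    two facts connect them.

    Since every component [A gamma] is nonzero, each well ordered set [T] is
    the support of some element of the Hahn product ([hahn_supp_surj]).  If
    [T] is in [F], the lift of such an element is again in the Rayner group
    and has support [aut_bar tau @` T]: stability of [F] follows.

    Conversely, stability gives at once that the lift maps the Rayner group
    into itself.  Equality of the image with the whole group also needs the
    inverse order automorphism: every [g] is the lift of some [a]
    ([canonical_lift_surj]), and the support of [a] is the image of that of
    [g] under the inverse of [aut_bar tau].  That inverse is the order part of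
    a skeleton automorphism too ([skeleton_aut_inv]), so stability applies to
    it and [a] lies in the Rayner group. *)

Import Order.TTheory GRing.Theory.
Local Open Scope ring_scope.

Section Supports.
Local Open Scope classical_set_scope.
Context {d : Order.disp_t} {Gamma : orderType d} {A : Gamma -> zmodType}.
Implicit Types (tau : skeleton_aut A) (g : hahn_product A).

Lemma hahn_supp_surj (T : set Gamma) :
  (forall gamma, exists x : A gamma, x != 0) -> well_ordered_set T ->
  exists g : hahn_product A, supp g = T.
Proof.
move=> A_nonzero woT.
pose c gamma : A gamma := if `[< T gamma >] then projT1 (cid (A_nonzero gamma))
                          else 0.
have suppc : supp c = T.
  apply/seteqP; split=> gamma; rewrite /supp /= /c; case: asboolP => //.
    by rewrite eqxx.
  by move=> _ _; case: cid.
have woc : well_ordered_set (supp c) by rewrite suppc.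
by exists (HahnProduct woc).
Qed.

Lemma additive_bij_inv (U V : zmodType) (f : {additive U -> V}) :
  bijective f -> exists g : {additive V -> U}, bijective g.
Proof.
case=> g fK gK.
pose gM := GRing.isZmodMorphism.Build V U g (can2_zmod_morphism fK gK).
pose ga : {additive V -> U} := HB.pack g gM.
by exists ga; exists f.
Qed.

(** Only the order part of the inverse is described, because supports do not
    depend on the choice of the component isomorphisms. *)
Lemma skeleton_aut_inv tau :
  exists tau' : skeleton_aut A, cancel (aut_bar tau) (aut_bar tau').
Proof.
have [h barK hK] := aut_bar_bij tau.
have h_mono : {mono h : x y / (x <= y)%O}.
  by move=> x y; rewrite -(aut_bar_mono tau) !hK.
(* With delta a variable, the equation can be eliminated, and no transport
   between A (aut_bar tau (h delta)) and A delta appears. *)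
have comp_inv gamma delta : aut_bar tau gamma = delta ->
    exists f : {additive A delta -> A gamma}, bijective f.
  by case: _ /; exact: additive_bij_inv (aut_comp_bij tau gamma).
pose comp delta := cid (comp_inv (h delta) delta (hK delta)).
have h_bij : bijective h by exists (aut_bar tau).
by exists (SkeletonAut h_bij h_mono (fun delta => projT2 (comp delta))).
Qed.

(** The coefficients of the preimage are found one at a time from the
    surjectivity of the components of [tau].  They form an element of the Hahn
    product because their support lies in the image of [supp g] under an order
    automorphism, so it is again well ordered. *)
Lemma canonical_lift_surj tau g : exists a, canonical_lift tau a = g.
Proof.
have comp_surj gamma (y : A (aut_bar tau gamma)) :
    exists x, aut_comp tau gamma x = y.
  by have [f _ fK] := aut_comp_bij tau gamma; exists (f y).
pose c gamma := projT1 (cid (comp_surj gamma (g (aut_bar tau gamma)))).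
have cE gamma : aut_comp tau gamma (c gamma) = g (aut_bar tau gamma).
  by rewrite /c; case: cid.
have [tau' barK] := skeleton_aut_inv tau.
have woc : well_ordered_set (supp c).
  apply: well_ordered_sub
    (well_ordered_image (aut_bar_mono tau') (@hahn_supp _ _ _ g)).
  move=> gamma cN0; exists (aut_bar tau gamma); last exact: barK.
  apply: contraNN cN0 => /eqP g0; apply/eqP.
  by apply: (bij_inj (aut_comp_bij tau gamma)); rewrite cE g0 raddf0.
exists (HahnProduct woc); apply: hahnP => delta.
have [gamma <-] := aut_bar_surj tau delta.
by rewrite [LHS]lift_coefE /= cE.
Qed.

End Supports.

Theorem theorem3p19 (d : Order.disp_t) (Gamma : orderType d)
    (A : Gamma -> zmodType)
    (A_nonzero : forall gamma : Gamma, exists x : A gamma, x != 0)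
    (F : set (set Gamma)) (F_family : group_family F) :
  canonical_lifting_property (rayner_group A F) <-> stable_under_aut A F.
Proof.
have [F_wo _ _] := F_family.
split=> [lifting tau T FT | stable tau].
  have [g suppg] := hahn_supp_surj T A_nonzero (F_wo T FT).
  have: rayner_group A F (canonical_lift tau g).
    by rewrite -(lifting tau); exists g; rewrite // /rayner_group /= suppg.
  by rewrite /rayner_group /= supp_lift_coef suppg.
apply/seteqP; split=> [_ [g Fg <-] | g Fg].
  by rewrite /rayner_group /= supp_lift_coef; apply: stable.
have [a liftE] := canonical_lift_surj tau g; exists a => //.
have [tau' barK] := skeleton_aut_inv tau.
have /(stable tau') := Fg.
rewrite -liftE supp_lift_coef image_comp.
by rewrite (_ : _ \o _ = id) ?image_id //; apply: funext.
Qed.
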